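(* If $f:\{0,1\}^4\to\{0,1\}$ is a Boolean function, then $Q_E(f)=4$ if and only if $f$ is isomorphic to $\mathrm{AND}_4$.
   Context: $\mathrm{AND}_4(x)=1$ iff all four bits are $1$. Two Boolean functions are isomorphic if one can be obtained from the other by permuting the input variables, negating some input variables, and possibly negating the output. $Q_E(f)$ is the exact quantum query complexity: the minimum number $t$ of queries in a quantum algorithm of the form $U_{t+1}QU_t\cdots QU_1$ applied to a fixed initial state in a Hilbert space with fixed orthonormal basis (the $U_j$ input-independent unitaries; $Q$ multiplies each basis state associated with index $i$ by $(-1)^{x_i}$ and fixes basis states associated with no index), followed by a measurement in that basis, whose output equals $f(x)$ with probability $1$ for every input $x$. *)

(* Defs.v *)
From mathcomp Require Import all_boot all_order all_fingroup all_algebra.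
From mathcomp Require Import spectral.
From mathcomp Require Import boolp classical_sets reals.
From mathcomp Require Import complex.

Set Implicit Arguments.
Unset Strict Implicit.
Unset Printing Implicit Defensive.

Import Order.TTheory GRing.Theory Num.Theory.

Local Open Scope ring_scope.

Definition AND (n : nat) (x : n.-tuple bool) : bool := [forall i, tnth x i].

Definition isomorphic (n : nat) (f g : n.-tuple bool -> bool) : Prop :=
  exists (s : 'S_n) (a : n.-tuple bool) (b : bool),
    forall x : n.-tuple bool,
      f x = g [tuple tnth x (s i) (+) tnth a i | i < n] (+) b.

(* Vectors are columns of coordinates in the fixed orthonormal basis
   'I_(qa_dim). Several basis states may carry the same index, which accounts
   for any workspace registers. qa_first is U_1 and qa_rest is
   (U_2, ..., U_(t+1)), so that a t-query algorithm has t + 1 unitaries.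
   qa_out is the classical postprocessing of the measurement outcome. *)
Record query_algorithm (R : realType) (n t : nat) := QueryAlgorithm {
  qa_dim : nat;
  qa_index : 'I_qa_dim -> option 'I_n;
  qa_init : 'cV[R[i]]_qa_dim;
  qa_first : 'M[R[i]]_qa_dim;
  qa_rest : t.-tuple 'M[R[i]]_qa_dim;
  qa_out : 'I_qa_dim -> bool;
  qa_init_unit : \sum_k `|qa_init k 0| ^+ 2 = 1;
  qa_first_unitary : qa_first \is unitarymx;
  qa_rest_unitary : forall j, tnth qa_rest j \is unitarymx
}.

Arguments qa_index {R n t} A k : rename.
Arguments qa_out {R n t} A k : rename.

Section QueryComplexity.
Context (R : realType) (n : nat).

Definition query_mx (N : nat) (index : 'I_N -> option 'I_n)
    (x : n.-tuple bool) : 'M[R[i]]_N :=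
  diag_mx (\row_k if index k is Some j then (-1) ^+ (tnth x j) else 1).

Definition final_state (t : nat) (A : query_algorithm R n t)
    (x : n.-tuple bool) : 'cV[R[i]]_(qa_dim A) :=
  foldl (fun psi U => U *m (query_mx (qa_index A) x *m psi))
    (qa_first A *m qa_init A) (qa_rest A).

Definition output_prob (t : nat) (A : query_algorithm R n t)
    (x : n.-tuple bool) (b : bool) : R[i] :=
  \sum_(k | qa_out A k == b) `|final_state A x k 0| ^+ 2.

Definition computes_exactly (t : nat) (A : query_algorithm R n t)
    (f : n.-tuple bool -> bool) : Prop :=
  forall x, output_prob A x (f x) = 1.

Definition exactly_computable (f : n.-tuple bool -> bool) (t : nat) : Prop :=
  exists A : query_algorithm R n t, computes_exactly A f.

(* The minimum exists, since n queries always suffice. The default value 0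
   of xget is not used. *)
Definition Q_E (f : n.-tuple bool -> bool) : nat :=
  xget 0%N [set t | exactly_computable f t /\
                    forall s, exactly_computable f s -> (t <= s)%N].

End QueryComplexity.

Arguments Q_E R {n} f.

(* Main.v *)
(* Upper bound.  Run a decision tree whose queries are uniform superpositions of
   [m] signed slots, a slot being an input bit or a constant.  The amplitudes
   v_i / sqrt m satisfy
     m * sum v_i w_i
       = (sum v_i) (sum w_i) + sum_(i < j) (v_i - v_j) (w_i - w_j),
   so there is a measurement after which one knows either that the v_i do not
   sum to 0 or that v_i <> v_j for some given i, j.  With [m = 2] this computes
   the parity of two slots, with [m = 4] it is the step of the EXACT_2 algorithm.
   If for some bit b the restriction of f to x_0 = b has an isolated point, then
   negations reduce f to one of 256 functions, of which all but one, isomorphic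
   to AND_4, are decided by a tree of depth 3; otherwise both restrictions are
   decided by trees of depth 2.  A tree only gives the Gram matrices of the
   intermediate states before and after each step, and a product of reflections
   realizes the step as a unitary.

   Lower bound.  If f takes one of its values only at y, some amplitude after t
   queries is supported on y alone; it is a polynomial of degree at most t in the
   signs of the bits, so t >= 4. *)

Require Import Defs.
From mathcomp Require Import all_boot all_order all_fingroup all_algebra.
From mathcomp Require Import spectral boolp reals complex ring.

Set Implicit Arguments.
Unset Strict Implicit.
Unset Printing Implicit Defensive.

Import Order.TTheory GRing.Theory Num.Theory.

(** * Gram matrices and products of reflections *)

Section Gram.
Local Open Scope ring_scope.
Variables (R : realFieldType) (N : nat).
Implicit Types u v w : 'cV[R]_N.

Definition dotc u v : R := (u^T *m v) 0 0.

Lemma dotcE u v : dotc u v = \sum_k u k 0 * v k 0.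
Proof. by rewrite /dotc mxE; apply: eq_bigr => k _; rewrite mxE. Qed.

Lemma dotc_eq0 u : dotc u u = 0 -> u = 0.
Proof.
rewrite dotcE => /eqP; rewrite psumr_eq0 => [/allP u0|k _]; last first.
  by rewrite -expr2 sqr_ge0.
apply/colP => k; rewrite mxE; apply/eqP.
by have := u0 k (mem_index_enum _); rewrite mulf_eq0 orbb.
Qed.

Lemma orthogonal_dotc (U : 'M[R]_N) u v :
  U^T *m U = 1%:M -> dotc (U *m u) (U *m v) = dotc u v.
Proof. by move=> UU; rewrite /dotc trmx_mul mulmxA -(mulmxA u^T) UU mulmx1. Qed.

Definition reflection v : 'M[R]_N := 1%:M - (2 / dotc v v) *: (v *m v^T).

Lemma reflectionE v u : reflection v *m u = u - (2 / dotc v v * dotc v u) *: v.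
Proof.
rewrite /reflection mulmxBl mul1mx -scalemxAl -mulmxA [v^T *m u]mx11_scalar.
by rewrite -[(v^T *m u) 0 0]/(dotc v u) mul_mx_scalar scalerA.
Qed.

Lemma dotcC u v : dotc u v = dotc v u.
Proof. by rewrite !dotcE; apply: eq_bigr => k _; rewrite mulrC. Qed.

Lemma dotcBl u v w : dotc (u - v) w = dotc u w - dotc v w.
Proof. by rewrite /dotc linearB mulmxBl !mxE. Qed.

Lemma dotcBr u v w : dotc w (u - v) = dotc w u - dotc w v.
Proof. by rewrite dotcC dotcBl !(dotcC w). Qed.

Lemma reflection_orthogonal v : (reflection v)^T *m reflection v = 1%:M.
Proof.
have [v0|v_neq0] := eqVneq (dotc v v) 0.
  by rewrite /reflection v0 invr0 mulr0 scale0r subr0 trmx1 mulmx1.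
have -> : (reflection v)^T = reflection v.
  by rewrite /reflection linearB linearZ /= trmx1 trmx_mul trmxK.
have PP : v *m v^T *m (v *m v^T) = dotc v v *: (v *m v^T).
  rewrite mulmxA -(mulmxA v) [v^T *m v]mx11_scalar -[(v^T *m v) 0 0]/(dotc v v).
  by rewrite mul_mx_scalar -scalemxAl.
rewrite /reflection mulmxBl mul1mx mulmxBr mulmx1 -scalemxAl -scalemxAr PP !scalerA.
rewrite -!mulrA mulVf // mulr1 -scalerBl -addrA -opprD -scalerDl.
by rewrite [X in X *: _](_ : _ = 0) ?scale0r ?subr0 //; ring.
Qed.

(* The reflection in the bisecting hyperplane of u and w swaps them and fixes
   every vector with the same inner product with both. *)
Lemma reflection_swap u w : dotc u u = dotc w w -> reflection (u - w) *m u = w.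
Proof.
move=> uw; rewrite reflectionE.
have [/dotc_eq0/eqP|n0] := eqVneq (dotc (u - w) (u - w)) 0.
  by rewrite subr_eq0 => /eqP->; rewrite subrr scaler0 subr0.
suff -> : 2 / dotc (u - w) (u - w) * dotc (u - w) u = 1.
  by rewrite scale1r opprB addrC subrK.
rewrite mulrAC; apply: (canLR (mulfK n0)); rewrite mul1r.
by rewrite !dotcBl !dotcBr uw (dotcC w u); ring.
Qed.

(** Induction on the list: one more reflection sends [U *m v z] to [w z], and it fixes every [w x]
    already attained, which has the same inner product with both. *)
Lemma orthogonal_of_gram (X : eqType) (v w : X -> 'cV[R]_N) (s : seq X) :
    {in s &, forall x y, dotc (v x) (v y) = dotc (w x) (w y)} ->
  exists2 U : 'M[R]_N, U^T *m U = 1%:M & {in s, forall x, U *m v x = w x}.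
Proof.
elim: s => [|z s IHs] gram; first by exists 1%:M; rewrite ?trmx1 ?mulmx1.
have [|U UU Uv] := IHs; first by apply: sub_in2 gram => x sx; rewrite inE sx orbT.
exists (reflection (U *m v z - w z) *m U) => [|x].
  by rewrite trmx_mul mulmxA -(mulmxA U^T) reflection_orthogonal mulmx1.
rewrite -mulmxA inE => /predU1P[->|sx].
  by apply: reflection_swap; rewrite orthogonal_dotc // gram ?mem_head.
have Uzx : dotc (U *m v z) (w x) = dotc (w z) (w x).
  rewrite -(gram z x) ?inE ?eqxx ?sx ?orbT // -[RHS](orthogonal_dotc _ _ UU).
  by rewrite (Uv x).
by rewrite (Uv x) // reflectionE (dotcBl _ _ (w x)) Uzx subrr mulr0 scale0r subr0.
Qed.
End Gram.

(** * Query protocols described by inner products *)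

Section Protocols.
Local Open Scope ring_scope.
Variables (R : realType) (n : nat).
Local Notation input := (n.-tuple bool).

Definition phase (x : input) (o : option 'I_n) : R :=
  if o is Some i then (-1) ^+ tnth x i else 1.

Lemma phase_sqr x o : phase x o * phase x o = 1.
Proof. by case: o => [i|] /=; rewrite ?mulr1 // -expr2 sqrr_sign. Qed.

(* [state j x] is the state after [j] queries. The unitaries are not recorded:
   they exist as soon as each step preserves inner products. *)
Record protocol (t : nat) (D : pred input) (f : input -> bool) := Protocol {
  basis : finType;
  index_of : basis -> option 'I_n;
  out : basis -> bool;
  state : nat -> input -> basis -> R;
  state_init : {in D &, forall x y, state 0 x =1 state 0 y};
  state_unit : {in D, forall x, \sum_k state 0 x k ^+ 2 = 1};
  state_step : forall j, (j < t)%N -> {in D &, forall x y,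
    \sum_k phase x (index_of k) * phase y (index_of k)
             * (state j x k * state j y k)
    = \sum_k state j.+1 x k * state j.+1 y k};
  state_out : {in D, forall x k, state t x k != 0 -> out k = f x} }.

Definition solvable t D f : Prop := inhabited (protocol t D f).

Lemma sub_solvable t (D D' : pred input) f :
  solvable t D f -> {subset D' <= D} -> solvable t D' f.
Proof.
move=> [[B idx o st s0 s1 ss so]] sD; split; exists B idx o st.
- exact: sub_in2 s0.
- exact: sub_in1 s1.
- by move=> j lt_jt; apply: sub_in2 (ss j lt_jt).
- exact: sub_in1 so.
Qed.

Lemma solvable_const t (D : pred input) f :
  {in D &, forall x y, f x = f y} -> solvable t D f.
Proof.
move=> fD; split; pose o := if [pick x in D] is Some x then f x else false.
exists unit (fun=> None) (fun=> o) (fun _ _ _ => 1) => //.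
- by move=> x _; rewrite big_const card_unit /= addr0 expr1n.
- by move=> j _ x y _ _; apply: eq_bigr => k _; rewrite !mulr1.
move=> x Dx _ _; rewrite /o; case: pickP => [y Dy|/(_ x)]; first exact: fD.
by rewrite Dx.
Qed.

Lemma sum_tagged (C : finType) (B : C -> finType) (F : forall c, B c -> R) :
  \sum_(ck : {c : C & B c}) F (tag ck) (tagged ck) = \sum_c \sum_k F c k.
Proof. by rewrite [RHS]sig_big_dep. Qed.

(* Run one query on the state [a], split the result into branches [c] with
   amplitudes [L c x], and continue in each branch with its own protocol. *)
Lemma solvable_measure t (D : pred input) f (I C : finType)
    (idx : I -> option 'I_n) (a : I -> R) (L : C -> input -> R) :
    \sum_i a i ^+ 2 = 1 ->
    {in D &, forall x y, \sum_i phase x (idx i) * phase y (idx i) * (a i * a i)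
                        = \sum_c L c x * L c y} ->
    (forall c, solvable t [pred x in D | L c x != 0] f) ->
  solvable t.+1 D f.
Proof.
move=> a1 aL solv.
have ex_p : forall c, exists _ : protocol t [pred x in D | L c x != 0] f, True.
  by move=> c; have [pc] := solv c; exists pc.
pose p c := projT1 (cid (ex_p c)); split; exists (I + {c : C & basis (p c)})%type
  (fun k : I + {c : C & basis (p c)} => match k with
     | inl i => idx i | inr ck => index_of (tagged ck) end)
  (fun k : I + {c : C & basis (p c)} => match k with
     | inl i => false | inr ck => out (tagged ck) end)
  (* The register [I] carries only the state at time 0; afterwards each branch runs its own
     protocol, one step late. *)
  (fun j x (k : I + {c : C & basis (p c)}) => match k with
     | inl i => if j is 0 then a i else 0
     | inr ck => if j is j'.+1 then L (tag ck) x * state j' x (tagged ck) else 0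
     end).
- by move=> x y _ _ [].
- move=> x Dx; rewrite big_sumType /= a1 [X in _ + X]big1 ?addr0 // => ck _.
  by rewrite expr0n.
- move=> [|j] lt_jt x y Dx Dy; rewrite !big_sumType /=.
    rewrite [X in _ + X]big1 ?addr0; last by move=> ck _; rewrite mul0r mulr0.
    rewrite [X in X + _]big1 ?add0r; last by move=> i _; rewrite mulr0.
    rewrite aL //.
    rewrite (sum_tagged (fun c (k : basis (p c)) =>
      L c x * state 0 x k * (L c y * state 0 y k))) /=.
    apply: eq_bigr => c _.
    have [Lx|Lx] := eqVneq (L c x) 0.
      by rewrite Lx mul0r big1 // => k _; rewrite !mul0r.
    have [Ly|Ly] := eqVneq (L c y) 0.
      by rewrite Ly mulr0 big1 // => k _; rewrite mul0r mulr0.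
    have Dcx : x \in [pred x in D | L c x != 0] by rewrite inE Lx andbT.
    have Dcy : y \in [pred x in D | L c x != 0] by rewrite inE Ly andbT.
    (* Inside a branch all inputs start in the same unit vector, so only the factor [L c x * L c y]
       remains. *)
    rewrite -[LHS]mulr1 -(state_unit (p c) Dcx) mulr_sumr; apply: eq_bigr => k _.
    by rewrite (state_init Dcy Dcx); ring.
  rewrite [X in X + _ = _]big1 ?add0r => [|i _]; last by rewrite !mulr0.
  rewrite [X in _ = X + _]big1 ?add0r => [|i _]; last by rewrite mulr0.
  rewrite (sum_tagged (fun c (k : basis (p c)) =>
    L c x * state j.+1 x k * (L c y * state j.+1 y k))) /=.
  rewrite (sum_tagged (fun c (k : basis (p c)) =>
    phase x (index_of k) * phase y (index_of k) *
    (L c x * state j x k * (L c y * state j y k)))) /=.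
  apply: eq_bigr => c _.
  have [Lx|Lx] := eqVneq (L c x) 0.
    by rewrite Lx !big1 // => k _; rewrite !mul0r ?mulr0.
  have [Ly|Ly] := eqVneq (L c y) 0.
    by rewrite Ly !big1 // => k _; rewrite mul0r ?mulr0.
  have Dcx : x \in [pred x in D | L c x != 0] by rewrite inE Lx andbT.
  have Dcy : y \in [pred x in D | L c x != 0] by rewrite inE Ly andbT.
  transitivity (L c x * L c y *
    \sum_k state (p := p c) j.+1 x k * state j.+1 y k).
    rewrite -state_step // mulr_sumr; apply: eq_bigr => k _; ring.
  by rewrite mulr_sumr; apply: eq_bigr => k _; ring.
- move=> x Dx [i|[c k]] /=; rewrite ?eqxx // mulf_eq0 negb_or => /andP[Lx].
  by apply: state_out; rewrite inE Lx andbT.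
Qed.

(** Negating inputs multiplies [phase x k] and [phase y k] by the same sign [phase a k], which
    cancels in [state_step]. *)
Lemma solvable_negate t (f : input -> bool) (a : input) (b : bool) :
  solvable t predT f ->
  solvable t predT (fun x => f [tuple tnth x i (+) tnth a i | i < n] (+) b).
Proof.
case=> [[B idx o st s0 s1 ss so]]; split.
pose h x : input := [tuple tnth x i (+) tnth a i | i < n].
have ph x k : phase (h x) k = phase x k * phase a k.
  by case: k => [i|] /=; rewrite ?mulr1 // tnth_mktuple signr_addb.
exists B idx (fun k => o k (+) b) (fun j x => st j (h x)).
- by move=> x y _ _; apply: s0.
- by move=> x _; apply: s1.
- move=> j lt_jt x y _ _; rewrite -ss //; apply: eq_bigr => k _.
  by rewrite !ph -[LHS]mulr1 -(phase_sqr a (idx k)); ring.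
- by move=> x _ k /so-> .
Qed.
End Protocols.

(** * From protocols to query algorithms *)

Section Realization.
Local Open Scope ring_scope.
Local Open Scope sesquilinear_scope.
Variables (R : realType) (n : nat).
Local Notation input := (n.-tuple bool).
Local Notation toC := (real_complex R).

Lemma real_unitary N (U : 'M[R]_N) :
  U^T *m U = 1%:M -> map_mx toC U \is unitarymx.
Proof.
move=> UU; apply/unitarymxP.
have -> : (map_mx toC U)^t* = map_mx toC U^T.
  by apply/matrixP => i j; rewrite !mxE; apply: conjc_real.
by rewrite -map_mxM (mulmx1C UU) map_mx1.
Qed.

(** [state_step] equates the Gram matrices of the queried states and of the next states, so
    [orthogonal_of_gram] over all inputs supplies a real orthogonal matrix for each step. *)
Lemma solvable_exactly_computable t (f : input -> bool) :
  solvable R t predT f -> exactly_computable R f t.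
Proof.
case=> p; pose N := #|basis p|.
pose vec j x : 'cV[R]_N := \col_k state (p := p) j x (enum_val k).
pose Q x : 'M[R]_N :=
  diag_mx (\row_k phase R x (index_of (enum_val k : basis p))).
have Qvec j x k : (Q x *m vec j x) k 0
    = phase R x (index_of (enum_val k : basis p)) * state j x (enum_val k).
  by rewrite mul_diag_mx !mxE.
have sum_val (F : basis p -> R) : \sum_(k < N) F (enum_val k) = \sum_k F k.
  by rewrite [RHS]big_enum_val.
have /choice[U U_P] (j : 'I_t) : exists U : 'M[R]_N,
    U^T *m U = 1%:M /\ forall x, U *m (Q x *m vec j x) = vec j.+1 x.
  have [x y _ _|U UU Uv] := @orthogonal_of_gram R N _
      (fun x => Q x *m vec j x) (vec j.+1) (enum {: input}).
    rewrite !dotcE; under eq_bigr => k _ do rewrite !Qvec.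
    under [RHS]eq_bigr => k _ do rewrite !mxE.
    rewrite (sum_val (fun k => state j.+1 x k * state j.+1 y k)) -state_step //.
    rewrite -sum_val; apply: eq_bigr => k _; ring.
  by exists U; split=> // x; apply: Uv; rewrite mem_enum.
pose x0 : input := [tuple false | i < n].
have toC_norm (a : R) : `|toC a| ^+ 2 = toC (a ^+ 2).
  by rewrite sqr_normc conjc_real -rmorphM.
have vec_unit j x : (j <= t)%N -> \sum_k vec j x k 0 ^+ 2 = 1.
  under eq_bigr => k _ do rewrite mxE.
  rewrite (sum_val (fun k => state j x k ^+ 2)).
  elim: j => [|j IHj] le_jt; first exact: state_unit.
  rewrite -[RHS](IHj (ltnW le_jt)); under eq_bigr => k _ do rewrite expr2.
  by rewrite -state_step //; apply: eq_bigr => k _; rewrite phase_sqr mul1r expr2.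
have init_unit : \sum_k `|map_mx toC (vec 0%N x0) k 0| ^+ 2 = 1.
  under eq_bigr => k _ do rewrite mxE toC_norm.
  by rewrite -rmorph_sum vec_unit.
have first_unitary : 1%:M \is @unitarymx R[i] N N.
  by apply/unitarymxP; rewrite trmx1 map_mx1 mulmx1.
have rest_unitary j : tnth [tuple map_mx toC (U j) | j < t] j \is unitarymx.
  by rewrite tnth_mktuple; apply: real_unitary; case: (U_P j).
pose A := @QueryAlgorithm R n t N (fun k => index_of (enum_val k : basis p)) _ _ _
  (fun k => out (enum_val k : basis p)) init_unit first_unitary rest_unitary.
exists A => x.
have final : final_state A x = map_mx toC (vec t x).
  rewrite /final_state /= mul1mx.
  have -> : vec 0%N x0 = vec 0%N x.
    by apply/colP => k; rewrite !mxE; apply: state_init.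
  set rest := [seq _ | _ <- _]; set g := (fun psi U => U *m _).
  have sz_rest : size rest = t by rewrite size_map size_enum_ord.
  suff prefix j : (j <= t)%N ->
      foldl g (map_mx toC (vec 0%N x)) (take j rest) = map_mx toC (vec j x).
    by rewrite -(prefix t) // -[X in take X]sz_rest take_size.
  elim: j => [|j IHj] lt_jt; first by rewrite take0.
  rewrite (take_nth 0) ?sz_rest // foldl_rcons (IHj (ltnW lt_jt)) /g.
  rewrite (nth_map (Ordinal lt_jt)) ?size_enum_ord //.
  rewrite (nth_ord_enum _ (Ordinal lt_jt)).
  rewrite -((U_P (Ordinal lt_jt)).2 x) !map_mxM; congr (_ *m (_ *m _)).
  apply/matrixP => k l; rewrite !mxE rmorphMn /=.
  by case: (index_of _) => [i|]; rewrite ?rmorph1 // rmorph_sign.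
rewrite /output_prob final /=.
under eq_bigr => k _ do rewrite mxE toC_norm.
(* By [state_out] no amplitude sits on a wrong outcome, so this partial sum is the full squared
   norm. *)
rewrite -rmorph_sum /= -[RHS](rmorph1 toC) -(vec_unit t x) // big_mkcond /=.
congr toC; apply: eq_bigr => k _; case: ifP => // /eqP out_k.
rewrite mxE; apply/esym/eqP; rewrite sqrf_eq0; apply/eqP.
by apply/eqP; apply: contraT => /(state_out (erefl : x \in predT)).
Qed.
End Realization.

(** * Lower bound by Fourier degree *)

Section LowerBound.
Local Open Scope ring_scope.
Local Open Scope sesquilinear_scope.
Variables (R : realType) (n : nat).
Local Notation input := (n.-tuple bool).
Implicit Types (S : {set 'I_n}) (x : input).

Lemma unitary_norm N (U : 'M[R[i]]_N) (v : 'cV_N) : U \is unitarymx ->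
  \sum_k `|(U *m v) k 0| ^+ 2 = \sum_k `|v k 0| ^+ 2.
Proof.
have normE (u : 'cV[R[i]]_N) : \sum_k `|u k 0| ^+ 2 = (u^t* *m u) 0 0.
  by rewrite mxE; apply: eq_bigr => k _; rewrite normCKC !mxE.
move=> /unitarymxP/mulmx1C UU.
by rewrite !normE trmx_mul map_mxM -mulmxA (mulmxA _ U) UU mul1mx.
Qed.

Lemma query_norm N (idx : 'I_N -> option 'I_n) x (v : 'cV[R[i]]_N) :
  \sum_k `|(query_mx R idx x *m v) k 0| ^+ 2 = \sum_k `|v k 0| ^+ 2.
Proof.
apply: eq_bigr => k _; rewrite mul_diag_mx !mxE normrM.
by case: (idx k) => [i|]; rewrite ?normr_sign ?normr1 mul1r.
Qed.

Lemma final_state_norm t (A : query_algorithm R n t) x :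
  \sum_k `|final_state A x k 0| ^+ 2 = 1.
Proof.
rewrite /final_state; have: forall U, U \in tval (qa_rest A) -> U \is unitarymx.
  by move=> U /tnthP[j ->]; apply: qa_rest_unitary.
elim/last_ind: (tval (qa_rest A)) => [|s U IHs] sU /=.
  by rewrite unitary_norm ?qa_init_unit // qa_first_unitary.
rewrite foldl_rcons unitary_norm ?sU ?mem_rcons ?mem_head // query_norm.
by apply: IHs => V sV; apply: sU; rewrite mem_rcons inE sV orbT.
Qed.

(** The Walsh character of [S]. *)
Definition character S x : R[i] := \prod_(i in S) (-1) ^+ tnth x i.

Definition flip (i : 'I_n) x : input := [tuple tnth x j (+) (j == i) | j < n].

Lemma flipK i : involutive (flip i).
Proof. by move=> x; apply: eq_from_tnth => j; rewrite !tnth_mktuple addbK. Qed.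

(** Flipping a bit of [S] reverses the sign of the character, so the sum equals its opposite. *)
Lemma sum_character S : (0 < #|S|)%N -> \sum_x character S x = 0.
Proof.
case/card_gt0P=> i Si; suff /eqP : (\sum_x character S x) *+ 2 = 0.
  by rewrite mulrn_eq0 => /eqP.
rewrite mulr2n {1}(reindex_inj (inv_inj (flipK i))) -big_split big1 //= => x _.
rewrite /character !(bigD1 i Si) /= tnth_mktuple eqxx addbT signrN mulNr.
rewrite [X in - (_ * X)](eq_bigr (fun j => (-1) ^+ tnth x j)) ?addNr //.
by move=> j /andP[_ /negPf j_i]; rewrite tnth_mktuple j_i addbF.
Qed.

(** Absorbing a queried sign toggles one index, so each query shrinks [S] by at most one. *)
Lemma characterD1 S i x :
  character S x * (-1) ^+ tnth x i
  = character (if i \in S then S :\ i else i |: S) x.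
Proof.
rewrite /character; case: ifP => Si.
  rewrite (big_setD1 i Si) mulrC mulrA -expr2 sqrr_sign mul1r //.
by rewrite big_setU1 ?Si //= mulrC.
Qed.

(* After [t] queries every amplitude is a polynomial of degree at most [t] in
   the signs of the bits, hence orthogonal to all characters of higher degree. *)
Lemma final_state_degree t (A : query_algorithm R n t) S k :
  (t < #|S|)%N -> \sum_x character S x * final_state A x k 0 = 0.
Proof.
rewrite /final_state -{1}(size_tuple (qa_rest A)).
elim/last_ind: (tval (qa_rest A)) S k => [|s U IHs] S k /= ltS.
  by rewrite -mulr_suml sum_character ?mul0r.
under eq_bigr => x _ do rewrite foldl_rcons mxE mulr_sumr.
rewrite exchange_big big1 //= => l _.
rewrite size_rcons in ltS.
transitivity (U k l * \sum_x character S x * (query_mx R (qa_index A) x *m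
   foldl (fun psi U => U *m (query_mx R (qa_index A) x *m psi))
     (qa_first A *m qa_init A) s) l 0).
  by rewrite mulr_sumr; apply: eq_bigr => x _; ring.
apply/eqP; rewrite mulf_eq0; apply/orP; right; apply/eqP.
under eq_bigr => x _ do rewrite mul_diag_mx !mxE mulrA.
case: (qa_index A l) => [i|]; last first.
  by under eq_bigr => x _ do rewrite mulr1; apply: IHs; apply: ltnW.
under eq_bigr => x _ do rewrite characterD1.
apply: IHs; case: ifP => Si; last by rewrite cardsU1 Si; do 2!apply: ltnW.
by rewrite (cardsD1 i S) Si in ltS.
Qed.

Lemma point_lower_bound t (f : input -> bool) (y : input) (b : bool) :
  (forall x, f x = (x == y) (+) b) -> exactly_computable R f t -> (n <= t)%N.
Proof.
move=> fE [A A_f]; rewrite leqNgt; apply/negP => lt_tn.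
(* For [x <> y] exactness excludes the outcome [k], so in the orthogonality to the full character
   only the term at [y] is left; hence it vanishes as well. *)
have amp0 k : qa_out A k = f y -> final_state A y k 0 = 0.
  move=> out_k.
  have := @final_state_degree t A [set: 'I_n] k.
  rewrite cardsT card_ord => /(_ lt_tn).
  rewrite (bigD1 y) //= big1 ?addr0 => [|x /negPf xy].
    move/eqP; rewrite mulf_eq0 => /orP[|/eqP //].
    by rewrite prodf_seq_eq0 => /hasP[i _]; rewrite signr_eq0 andbF.
  suff /eqP : `|final_state A x k 0| ^+ 2 = 0.
    by rewrite sqrf_eq0 normr_eq0 => /eqP->; rewrite mulr0.
  have := final_state_norm A x; rewrite (bigID (fun l => qa_out A l == f x)) /=.
  rewrite -/(output_prob A x (f x)) A_f -[RHS]addr0 => /addrI/eqP.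
  rewrite psumr_eq0 => [/allP/(_ k (mem_index_enum _))|l _]; last first.
    exact: exprn_ge0.
  by rewrite out_k !fE eqxx xy; case: (b) => /eqP.
have := A_f y; rewrite /output_prob big1 => [/eqP|k /eqP/amp0->]; last first.
  by rewrite normr0 expr0n.
by rewrite eq_sym oner_eq0.
Qed.
End LowerBound.

(** * Decision trees with superposed queries *)

Section DecisionTrees.
Variable n : nat.
Local Notation input := (n.-tuple bool).

(* [(Some i, c)] is bit [i] xored with [c], and [(None, c)] the constant [c]. *)
Definition slot := (option 'I_n * bool)%type.

Definition slot_bit (x : input) (s : slot) : bool :=
  (if s.1 is Some i then tnth x i else false) (+) s.2.

(** In terms of signs: those of the slots in [S] sum to 0. *)
Definition balanced (S : seq slot) (x : input) : bool :=
  count (slot_bit x) S == count (negb \o slot_bit x) S.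

(* [g] is the graph of the function on the inputs that are still possible, and
   [levels] lists the queries allowed at each depth of the tree. *)
Fixpoint decidable_by (levels : seq (seq (seq slot)))
    (g : seq (input * bool)) : bool :=
  constant (unzip2 g) ||
  if levels is l :: levels' then
    has (fun S => [&& S != [::],
       decidable_by levels' [seq p <- g | ~~ balanced S p.1] &
       all (fun s => all (fun s' => decidable_by levels'
         [seq p <- g | slot_bit p.1 s != slot_bit p.1 s']) S) S]) l
  else false.

Local Open Scope ring_scope.
Variable R : realType.
Implicit Types (f : input -> bool) (D : pred input).

Lemma sum_signs (T : Type) (b : T -> bool) (s : seq T) :
  \sum_(i <- s) (-1) ^+ b i = (count (negb \o b) s)%:R - (count b s)%:R :> R.
Proof.
elim: s => [|i s IHs]; first by rewrite big_nil subrr.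
by rewrite big_cons IHs /= !natrD; case: (b i); rewrite /= ?expr0 ?expr1; ring.
Qed.

(** Polarized Lagrange identity; ordered pairs count each difference twice. *)
Lemma sum_mul_diff (I : finType) (p q : I -> R) :
  \sum_i \sum_j (p i - p j) * (q i - q j)
  = 2 * (#|I|%:R * (\sum_i p i * q i) - (\sum_i p i) * (\sum_i q i)).
Proof.
have prodE : (\sum_i p i) * (\sum_i q i) = \sum_i \sum_j p i * q j.
  by rewrite mulr_suml; apply: eq_bigr => i _; rewrite mulr_sumr.
have diagE : #|I|%:R * (\sum_i p i * q i) = \sum_i \sum_(j : I) p i * q i.
  by rewrite mulr_sumr; apply: eq_bigr => i _; rewrite sumr_const mulr_natl.
transitivity
  (\sum_(i : I) \sum_(j : I) p i * q i + \sum_(i : I) \sum_(j : I) p j * q j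
   - (\sum_(i : I) \sum_(j : I) p i * q j
      + \sum_(i : I) \sum_(j : I) p j * q i)); last first.
  rewrite [X in _ + X - _]exchange_big [X in _ - (_ + X)]exchange_big /=.
  by rewrite -prodE -diagE; ring.
rewrite -!big_split -sumrB; apply: eq_bigr => i _.
rewrite -!big_split -sumrB; apply: eq_bigr => j _ /=; ring.
Qed.

(* The differences of all ordered pairs of slots are measured, so each carries
   an extra factor 1 / sqrt 2. *)
Lemma solvable_slots t D f (S : seq slot) : S != [::] ->
    solvable R t [pred x in D | ~~ balanced S x] f ->
    {in S &, forall s s',
      solvable R t [pred x in D | slot_bit x s != slot_bit x s'] f} ->
  solvable R t.+1 D f.
Proof.
move=> S_neq0 solv_sum solv_diff; set m := size S.
have m_gt0 : 0 < m%:R :> R by rewrite ltr0n lt0n size_eq0.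
have m_neq0 := lt0r_neq0 m_gt0.
pose slot_at (i : 'I_m) := tnth (in_tuple S) i.
have slot_atS i : slot_at i \in S by apply: mem_tnth.
pose v i x : R := (-1) ^+ slot_bit x (slot_at i).
have sum_v x : \sum_i v i x
    = (count (negb \o slot_bit x) S)%:R - (count (slot_bit x) S)%:R.
  by rewrite -sum_signs (big_tnth _ _ S).
have sqrt_m : Num.sqrt m%:R * Num.sqrt m%:R = m%:R :> R.
  by rewrite -expr2 sqr_sqrtr // ltW.
have [r sqrt_2] : exists r : R, r * r = 2.
  by exists (Num.sqrt 2); rewrite -expr2 sqr_sqrtr.
(* A nonzero amplitude is the knowledge gained: the signs do not sum to 0 ([inl]), or slots [i] and
   [j] differ ([inr]). *)
pose L (c : unit + 'I_m * 'I_m) x : R := match c with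
  | inl _ => (\sum_i v i x) / m%:R
  | inr ij => (v ij.1 x - v ij.2 x) / (m%:R * r) end.
(* The negation of a slot goes into the sign of the initial amplitude. *)
apply: (solvable_measure (idx := fun i => (slot_at i).1)
  (a := fun i => (-1) ^+ (slot_at i).2 / Num.sqrt m%:R) (L := L)).
- transitivity (\sum_(i < m) m%:R^-1 : R); last first.
    by rewrite sumr_const card_ord -[LHS]mulr_natl mulfV.
  by apply: eq_bigr => i _; rewrite exprMn sqrr_sign mul1r expr2 -invfM sqrt_m.
- move=> x y _ _.
  transitivity ((\sum_i v i x * v i y) / m%:R).
    rewrite mulr_suml; apply: eq_bigr => i _.
    have vE z : v i z = phase R z (slot_at i).1 * (-1) ^+ (slot_at i).2.
      by rewrite /v /slot_bit signr_addb; case: (slot_at i).1.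
    by rewrite !vE -{3}sqrt_m invfM; ring.
  rewrite big_sumType /= big_const card_unit /= addr0.
  rewrite -(pair_bigA _ (fun i j => (v i x - v j x) / (m%:R * r) *
     ((v i y - v j y) / (m%:R * r)))) /=.
  transitivity ((\sum_i v i x) / m%:R * ((\sum_i v i y) / m%:R) +
     (\sum_i \sum_j (v i x - v j x) * (v i y - v j y)) / (m%:R * m%:R * 2)).
    by rewrite sum_mul_diff card_ord; field.
  congr (_ + _); rewrite mulr_suml; apply: eq_bigr => i _.
  rewrite mulr_suml; apply: eq_bigr => j _; rewrite -sqrt_2 !invfM; ring.
case=> [u|[i j]]; last first.
  apply: (sub_solvable (solv_diff _ _ (slot_atS i) (slot_atS j))) => x.
  rewrite !inE /= => /andP[-> /=]; apply: contra => /eqP eq_ij.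
  by rewrite /v eq_ij subrr mul0r.
apply: (sub_solvable solv_sum) => x; rewrite !inE /= => /andP[-> /=].
by apply: contra => /eqP eqS; rewrite sum_v eqS subrr mul0r.
Qed.

(** Querying the constant 0 together with bit [i] reads the bit: the two slots are balanced, that is
    different, exactly when it is 1. *)
Lemma solvable_bit t D f (i : 'I_n) :
  (forall b, solvable R t [pred x in D | tnth x i == b] f) ->
  solvable R t.+1 D f.
Proof.
move=> solv.
apply: (@solvable_slots _ _ _ [:: (None, false); (Some i, false)]) => //.
  apply: (sub_solvable (solv false)) => x; rewrite !inE /balanced /slot_bit /=.
  by case: (tnth x i); rewrite ?andbF.
by move=> s s'; rewrite !inE => /orP[] /eqP-> /orP[] /eqP->;
  apply: (sub_solvable (solv true)) => x; rewrite !inE /slot_bit /=;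
  case: (tnth x i); rewrite ?andbF.
Qed.

Lemma solvable_bits (s : seq 'I_n) D f :
    {in D &, forall x y, {in s, tnth x =1 tnth y} -> x = y} ->
  solvable R (size s) D f.
Proof.
elim: s D => [|i s IHs] D sD.
  by apply: solvable_const => x y Dx Dy; rewrite (sD x y).
apply: (@solvable_bit _ _ _ i) => b; apply: IHs => x y.
rewrite !inE => /andP[Dx /eqP xi] /andP[Dy /eqP yi] eq_s.
by apply: sD => // j; rewrite inE => /predU1P[->|/eq_s//]; rewrite xi.
Qed.

Lemma solvable_all f : solvable R n predT f.
Proof.
rewrite -[n in solvable _ n]size_enum_ord; apply: solvable_bits => x y _ _ eq_xy.
by apply: eq_from_tnth => i; rewrite eq_xy ?mem_enum.
Qed.

Lemma decidable_by_solvable levels D (g : seq (input * bool)) f :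
    decidable_by levels g -> {in g, forall p, f p.1 = p.2} ->
    {subset D <= unzip1 g} ->
  solvable R (size levels) D f.
Proof.
have const_g t D' g' : constant (unzip2 g') -> {in g', forall p, f p.1 = p.2} ->
    {subset D' <= unzip1 g'} -> solvable R t D' f.
  move=> cg fg sD; apply: solvable_const => x y.
  move=> /sD/mapP[p gp ->] /sD/mapP[q gq ->].
  rewrite !fg //; suff eq_c z : z \in unzip2 g' -> z = head false (unzip2 g').
    by rewrite (eq_c p.2) ?map_f // -(eq_c q.2) ?map_f.
  case: (unzip2 g') cg => //= b s /allP bs; rewrite inE => /predU1P[//|].
  by move=> /bs/eqP.
have sub_filter (P : pred input) D' (g' : seq (input * bool)) :
    {subset D' <= unzip1 g'} ->
    {subset [pred x in D' | P x] <= unzip1 [seq p <- g' | P p.1]}.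
  move=> sD x /andP[/sD/mapP[p gp ->] Pp].
  by apply/mapP; exists p; rewrite // mem_filter andbC gp.
elim: levels D g => [|l levels IHl] D g /= /orP[/const_g|] // solv fg sD;
  try exact: solv.
have {solv} /hasP[S _ /and3P[S_neq0 solv_sum /allP solv_diff]] := solv.
have fgP P : {in [seq p <- g | P p], forall p, f p.1 = p.2}.
  by move=> p; rewrite mem_filter => /andP[_ /fg].
apply: (solvable_slots S_neq0) => [|s s' Ss Ss'].
  by apply: IHl solv_sum (fgP _) _; apply: sub_filter.
have /allP/(_ s' Ss') solv_ss' := solv_diff s Ss.
apply: IHl solv_ss' (fgP _) _.
exact: (sub_filter (fun x => slot_bit x s != slot_bit x s')).
Qed.
End DecisionTrees.

(** * Exhaustive search over truth tables *)

Fixpoint bitseqs (m : nat) : seq (seq bool) :=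
  if m is m'.+1 then [seq b :: s | b <- [:: false; true], s <- bitseqs m']
  else [:: [::]].

Lemma mem_bitseqs (s : seq bool) : s \in bitseqs (size s).
Proof.
by elim: s => [|b s IHs] //; apply: (allpairs_f cons) => //; case: b.
Qed.

(** The order fixes the layout of truth tables; the head has its last three bits 0. *)
Definition half_cube (b : bool) : seq (4.-tuple bool) :=
  [seq [tuple b; nth false s 0; nth false s 1; nth false s 2] | s <- bitseqs 3].

Lemma mem_half_cube (b : bool) (x : 4.-tuple bool) :
  (x \in half_cube b) = (tnth x ord0 == b).
Proof.
apply/mapP/eqP => [[s _ ->] // | <-].
exists (behead x).
  by have := mem_bitseqs (behead x); rewrite size_behead size_tuple.
by case: x => [[|x0 [|x1 [|x2 [|x3 []]]]] //= ?]; apply: val_inj.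
Qed.

Definition bit_slot (k : nat) (lt_k4 : k < 4) : slot 4 :=
  (Some (Ordinal lt_k4), false).

Definition slots : seq (slot 4) :=
  [:: (None, false); @bit_slot 0 isT; @bit_slot 1 isT;
      @bit_slot 2 isT; @bit_slot 3 isT].

(** Unordered pairs without signs suffice: negating one slot only exchanges the two outcomes. *)
Definition slot_pairs : seq (seq (slot 4)) :=
  [seq S <- [seq [:: s; s'] | s <- slots, s' <- slots]
    | subseq S slots & uniq S].

(* A global sign is irrelevant, so the first slot is never negated. *)
Definition signed_quads : seq (seq (slot 4)) :=
  [seq [seq (p.1.1, p.2) | p <- zip (rem s slots) (false :: c)]
    | s <- slots, c <- bitseqs 3].

Definition isolated (T : eqType) (g : seq (T * bool)) : bool :=
  has (fun p => all (fun q => (q.2 == p.2) == (q.1 == p.1)) g) g.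

(** Computation over the 256 truth tables [v] on three bits. *)
Lemma half_cube_decidable b :
  all (fun v => isolated (zip (half_cube b) v) ||
         decidable_by [:: slot_pairs ++ signed_quads; slot_pairs]
           (zip (half_cube b) v))
      (bitseqs 8).
Proof. by case: b; exact isT. Qed.

(** The fixed half of the table is 1 at the zero input only, [v] is the half where the first bit is
    1; an all-false [v] is the exception isomorphic to [AND]. *)
Lemma cube_decidable :
  all (fun v => ~~ has id v ||
         decidable_by [:: slot_pairs; slot_pairs ++ signed_quads; slot_pairs]
           (zip (half_cube false ++ half_cube true)
             (true :: nseq 7 false ++ v)))
      (bitseqs 8).
Proof. exact isT. Qed.

Lemma isomorphic_AND n (f : n.-tuple bool -> bool) :
  isomorphic f (@AND n) <-> exists y b, forall x, f x = (x == y) (+) b.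
Proof.
split=> [[s [a [b fE]]] | [y [b fE]]].
  (* The point solving [y_(s i) (+) a_i = 1] for all [i]. *)
  exists [tuple ~~ tnth a ((s^-1)%g i) | i < n], b => x.
  rewrite fE; congr (_ (+) b); apply/forallP/eqP => [ANDx | -> i]; last first.
    by rewrite !tnth_mktuple permK addNb addbb.
  apply: eq_from_tnth => i; have := ANDx ((s^-1)%g i).
  by rewrite !tnth_mktuple permKV; case: (tnth x i); case: (tnth a _).
exists 1%g, [tuple ~~ tnth y i | i < n], b => x; rewrite fE; congr (_ (+) b).
apply/eqP/forallP => [-> i | ANDx].
  by rewrite !tnth_mktuple perm1 addbN addbb.
apply: eq_from_tnth => i; have := ANDx i; rewrite !tnth_mktuple perm1.
by case: (tnth x i); case: (tnth y i).
Qed.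

(** * Functions of four bits *)

Section FourBits.
Variable R : realType.
Implicit Type f : 4.-tuple bool -> bool.

Lemma zip_graph (T U : Type) (f : T -> U) (s : seq T) :
  zip s (map f s) = [seq (x, f x) | x <- s].
Proof. by rewrite -[X in zip X]map_id zip_map. Qed.

Lemma unzip1_graph (T U : Type) (f : T -> U) (s : seq T) :
  unzip1 [seq (x, f x) | x <- s] = s.
Proof. by rewrite /unzip1 -map_comp map_id. Qed.

Lemma half_cube_dichotomy f (b : bool) :
  solvable R 2 [pred x | tnth x ord0 == b] f \/
  exists2 y, tnth y ord0 = b &
    forall x, tnth x ord0 = b -> (f x == f y) = (x == y).
Proof.
have /orP := allP (half_cube_decidable b) _ (mem_bitseqs (map f (half_cube b))).
rewrite zip_graph => -[/hasP[p] | dec].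
  case/mapP=> y; rewrite mem_half_cube => /eqP yb -> /allP iso.
  right; exists y => // x xb.
  have /iso/eqP/= : (x, f x) \in [seq (x, f x) | x <- half_cube b].
    by apply: map_f; rewrite mem_half_cube xb.
  by [].
left; apply: (decidable_by_solvable R dec) => [p /mapP[x _ ->] //|x xb].
by rewrite unzip1_graph mem_half_cube.
Qed.

Lemma solvable3 f : ~ isomorphic f (@AND 4) -> solvable R 3 predT f.
Proof.
move=> not_AND.
have [halves|] :=
  pselect (forall b, solvable R 2 [pred x | tnth x ord0 == b] f).
  by apply: (@solvable_bit 4 R 2 predT f ord0).
case/existsNP=> b not_solv; have [//|[y yb fy]] := half_cube_dichotomy f b.
(* Xor with [y] moves the isolated point to the zero input [z], and its half to the half where the
   first bit is 0; [f'] also normalizes the value at [z] to true. *)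
pose h (x : 4.-tuple bool) := [tuple tnth x i (+) tnth y i | i < 4].
have hK : involutive h.
  by move=> x; apply: eq_from_tnth => i; rewrite !tnth_mktuple addbK.
pose z : 4.-tuple bool := [tuple false; false; false; false].
have hz : h z = y.
  apply: eq_from_tnth => i; rewrite !tnth_mktuple.
  by case: i => [[|[|[|[|]]]]].
pose f' x := f (h x) (+) ~~ f y.
have -> : f = (fun x => f' (h x) (+) ~~ f y).
  by apply/funext => x; rewrite /f' hK addbK.
apply: solvable_negate.
have f'z x : tnth x ord0 = false -> f' x = (x == z).
  move=> x0; have := fy (h x); rewrite tnth_mktuple x0 yb => /(_ erefl).
  rewrite -[in X in _ = X -> _]hz (inj_eq (inv_inj hK)) /f' => <-.
  by case: (f _); case: (f _).
have f'_false : map f' (half_cube false) = true :: nseq 7 false.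
  rewrite (@eq_in_map _ _ f' (fun x => x == z) _).1 // => x.
  by rewrite mem_half_cube => /eqP/f'z.
(* Either [f'] vanishes on the other half, and is then the indicator of [z], or the search yields a
   tree of depth 3. *)
have /orP := allP cube_decidable _ (mem_bitseqs (map f' (half_cube true))).
rewrite -cat_cons -f'_false -map_cat => -[/hasPn f'0|dec].
  case: not_AND; apply/isomorphic_AND; exists y, (~~ f y) => x.
  rewrite -[x]hK -hz (inj_eq (inv_inj hK)).
  case x0: (tnth (h x) ord0); last by rewrite hz -f'z // /f' addbK.
  rewrite -[LHS](addbK (~~ f y)) -/(f' (h x)) hz; congr (_ (+) _).
  have /negPf-> : ~~ f' (h x) by apply: f'0; rewrite map_f // mem_half_cube x0.
  by apply/esym/eqP => hx; rewrite hx in x0.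
rewrite zip_graph in dec.
apply: (decidable_by_solvable R dec) => [p /mapP[x _ ->] //|x _].
by rewrite unzip1_graph mem_cat !mem_half_cube; case: (tnth x _).
Qed.
End FourBits.

(** * The minimum number of queries *)

Lemma Q_EP (R : realType) n (f : n.-tuple bool -> bool) :
  exactly_computable R f (Q_E R f) /\
  forall t, exactly_computable R f t -> Q_E R f <= t.
Proof.
apply: (@classical_sets.xgetPex _ 0 (fun t => exactly_computable R f t /\
  forall s, exactly_computable R f s -> t <= s)).
have ex_t : exists t, `[< exactly_computable R f t >].
  by exists n; apply/asboolP/solvable_exactly_computable/solvable_all.
exists (ex_minn ex_t); case: ex_minnP => t /asboolP comp_t min_t.
by split=> // s comp_s; apply: min_t; apply/asboolP.
Qed.

Theorem theorem6 (R : realType) (f : 4.-tuple bool -> bool) :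
  Q_E R f = 4 <-> isomorphic f (@AND 4).
Proof.
have [comp min_Q] := Q_EP R f; split=> [Q4 | /isomorphic_AND[y [b fE]]].
  apply: contrapT => /(solvable3 R)/solvable_exactly_computable/min_Q.
  by rewrite Q4.
apply/eqP; rewrite eqn_leq (point_lower_bound fE comp) andbT.
by apply/min_Q/solvable_exactly_computable/solvable_all.
Qed.
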